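(* For $p=110$, we have $$C_p(x,y)=\frac{1-3x+2x^2+x^3-x^4+x^4y}{(1-x)(1-3x+x^2+2x^3-x^3y)}.$$
   Context: A Catalan word of length $n\geq 1$ is a word $w_1\ldots w_n$ over the non-negative integers with $w_1=0$ and $0\leq w_i\leq w_{i-1}+1$ for $2\leq i\leq n$; the empty word is the unique Catalan word of length $0$. A word $w$ contains the pattern $p=p_1\ldots p_k$ if there are indices $i_1<\cdots<i_k$ such that $w_{i_1}\ldots w_{i_k}$ is order-isomorphic to $p$ (for all $a,b$: $w_{i_a}<w_{i_b}$ iff $p_a<p_b$, and $w_{i_a}=w_{i_b}$ iff $p_a=p_b$); otherwise $w$ avoids $p$. $\mathcal{C}_n(p)$ is the set of Catalan words of length $n$ avoiding $p$. A descent of $w$ is an index $i$ with $w_i>w_{i+1}$. $C_p(x,y)=\sum_{n,k\geq 0}c_{n,k}x^ny^k$, where $c_{n,k}$ is the number of words in $\mathcal{C}_n(p)$ with exactly $k$ descents. *)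

(* Defs.v *)
From HB Require Import structures.
From mathcomp Require Import all_boot all_order all_algebra.
From mathcomp Require Import boolp.

Set Implicit Arguments.
Unset Strict Implicit.
Unset Printing Implicit Defensive.

Import GRing.Theory.

Local Open Scope ring_scope.

(* Formal power series R[[X]]; a series in two variables is an element of
   {fps {fps R}}. *)
Record fps (R : Type) := FPS { fpscoef : nat -> R }.

Notation "{ 'fps' R }" := (fps R) (at level 0, format "{ 'fps'  R }") : type_scope.

HB.instance Definition _ (R : Type) := gen_eqMixin {fps R}.
HB.instance Definition _ (R : Type) := gen_choiceMixin {fps R}.

Lemma fpsP (R : Type) (f g : {fps R}) :
  (forall n, fpscoef f n = fpscoef g n) -> f = g.
Proof. by case: f g => [f] [g] /= fg; congr FPS; apply/funext. Qed.

Section FpsZmodule.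
Variable R : zmodType.
Implicit Types f g h : {fps R}.

Definition fps_zero : {fps R} := FPS (fun=> 0).
Definition fps_opp f : {fps R} := FPS (fun n => - fpscoef f n).
Definition fps_add f g : {fps R} := FPS (fun n => fpscoef f n + fpscoef g n).

Fact fps_addA : associative fps_add.
Proof. by move=> f g h; apply: fpsP => n /=; rewrite addrA. Qed.
Fact fps_addC : commutative fps_add.
Proof. by move=> f g; apply: fpsP => n /=; rewrite addrC. Qed.
Fact fps_add0 : left_id fps_zero fps_add.
Proof. by move=> f; apply: fpsP => n /=; rewrite add0r. Qed.
Fact fps_addN : left_inverse fps_zero fps_opp fps_add.
Proof. by move=> f; apply: fpsP => n /=; rewrite addNr. Qed.

HB.instance Definition _ :=
  GRing.isZmodule.Build {fps R} fps_addA fps_addC fps_add0 fps_addN.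

End FpsZmodule.

Section FpsRing.
Variable R : comNzRingType.
Implicit Types f g h : {fps R}.

Definition fpsC (c : R) : {fps R} := FPS (fun n => if n is 0 then c else 0).
Definition fpsX : {fps R} := FPS (fun n => (n == 1%N)%:R).
Definition fps_mul f g : {fps R} :=
  FPS (fun n => \sum_(i < n.+1) fpscoef f i * fpscoef g (n - i)).

Definition fps_trunc m f : {poly R} := \poly_(i < m) fpscoef f i.

Lemma fps_mul_trunc m n f g : (n < m)%N ->
  fpscoef (fps_mul f g) n = (fps_trunc m f * fps_trunc m g)`_n.
Proof.
move=> lt_nm; rewrite coefM /=; apply: eq_bigr => i _; rewrite !coef_poly.
by rewrite (leq_ltn_trans _ lt_nm) ?(leq_ltn_trans _ lt_nm) ?leq_subr // -ltnS.
Qed.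

Fact fps_mulC : commutative fps_mul.
Proof.
by move=> f g; apply: fpsP => n; rewrite !(@fps_mul_trunc n.+1) // mulrC.
Qed.

Fact fps_mulA : associative fps_mul.
Proof.
have truncM f g h n : fpscoef (fps_mul f (fps_mul g h)) n =
    (fps_trunc n.+1 f * (fps_trunc n.+1 g * fps_trunc n.+1 h))`_n.
  rewrite coefM; apply: eq_bigr => i _; rewrite coef_poly ltn_ord.
  by rewrite (@fps_mul_trunc n.+1) // ltnS leq_subr.
move=> f g h; apply: fpsP => n.
by rewrite (fps_mulC (fps_mul f g)) !truncM mulrA mulrC.
Qed.

Fact fps_mul1 : left_id (fpsC 1) fps_mul.
Proof.
move=> f; apply: fpsP => n /=; rewrite big_ord_recl /= mul1r subn0.
by rewrite big1 ?addr0 // => i _; rewrite mul0r.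
Qed.

Fact fps_mulDl : left_distributive fps_mul (@fps_add R).
Proof.
move=> f g h; apply: fpsP => n /=; rewrite -big_split /=.
by apply: eq_bigr => i _; rewrite mulrDl.
Qed.

Fact fps_oner_neq0 : fpsC 1 != 0.
Proof.
apply/eqP => /(congr1 (fun f => fpscoef f 0)) /= /eqP.
by rewrite oner_eq0.
Qed.

HB.instance Definition _ := GRing.Zmodule_isComNzRing.Build {fps R}
  fps_mulA fps_mulC fps_mul1 fps_mulDl fps_oner_neq0.

End FpsRing.

Arguments fpsX {R}.

Section FpsUnitRing.
Variable R : comUnitRingType.
Implicit Types f g : {fps R}.

Definition fps_unit : pred {fps R} := fun f => fpscoef f 0 \is a GRing.unit.

(* The first n coefficients of 1 / f, obtained by solving the coefficients of
   f * g = 1 one after the other. *)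
Fixpoint fps_inv_seq f n : seq R :=
  if n is m.+1 then
    let s := fps_inv_seq f m in
    rcons s (((m == 0%N)%:R - \sum_(i < m) s`_i * fpscoef f (m - i))
             / fpscoef f 0)
  else [::].

Definition fps_inv f : {fps R} :=
  if fps_unit f then FPS (fun n => (fps_inv_seq f n.+1)`_n) else f.

Lemma size_fps_inv_seq f n : size (fps_inv_seq f n) = n.
Proof. by elim: n => //= n IHn; rewrite size_rcons IHn. Qed.

Lemma nth_fps_inv_seq f m n : (m < n)%N ->
  (fps_inv_seq f n)`_m = (fps_inv_seq f m.+1)`_m.
Proof.
elim: n => // n IHn; rewrite ltnS leq_eqVlt => /orP[/eqP -> //|lt_mn].
by rewrite [LHS]/= nth_rcons size_fps_inv_seq lt_mn IHn.
Qed.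

Fact fps_mulVr : {in fps_unit, left_inverse 1 fps_inv *%R}.
Proof.
move=> f uf; rewrite /fps_inv ifT //; rewrite unfold_in in uf.
apply: fpsP => n; rewrite [LHS]/= big_ord_recr subnn.
rewrite [X in _ + X]/= nth_rcons size_fps_inv_seq ltnn eqxx divrK //.
have -> : \sum_(i < n) fpscoef (FPS (fun n => (fps_inv_seq f n.+1)`_n)) i
    * fpscoef f (n - i) = \sum_(i < n) (fps_inv_seq f n)`_i * fpscoef f (n - i).
  by apply: eq_bigr => i _; rewrite (nth_fps_inv_seq f (ltn_ord i)).
by rewrite [LHS]addrC subrK; case: n {uf}.
Qed.

Fact fps_unitP f g : g * f = 1 -> fps_unit f.
Proof.
move=> /(congr1 (fun h => fpscoef h 0)) /=.
rewrite big_ord_recl big_ord0 addr0 subnn => gf1.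
by rewrite /fps_unit; apply/unitrP; exists (fpscoef g 0); rewrite [X in _ /\ X = _]mulrC gf1.
Qed.

Fact fps_inv_out : {in [predC fps_unit], fps_inv =1 id}.
Proof. by move=> f uf; rewrite /fps_inv ifN. Qed.

HB.instance Definition _ := GRing.ComNzRing_hasMulInverse.Build {fps R}
  fps_mulVr fps_unitP fps_inv_out.

End FpsUnitRing.

Local Open Scope nat_scope.

Definition catalan_word (w : seq nat) : bool :=
  (head 0 w == 0) && sorted (fun a b => b <= a.+1) w.

Definition contains_pattern (w p : seq nat) : bool :=
  [exists f : {ffun 'I_(size p) -> 'I_(size w)},
    [forall a : 'I_(size p), forall b : 'I_(size p),
      [&& (a < b) ==> (f a < f b),
          (nth 0 w (f a) < nth 0 w (f b)) == (nth 0 p a < nth 0 p b)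
        & (nth 0 w (f a) == nth 0 w (f b)) == (nth 0 p a == nth 0 p b)]]].

Definition avoids (w p : seq nat) : bool := ~~ contains_pattern w p.

Definition descents (w : seq nat) : nat :=
  \sum_(i < (size w).-1) (nth 0 w i.+1 < nth 0 w i).

(* The letters of a Catalan word of length n are smaller than n (see
   catalan_word_bound), so that those words are tuples over 'I_n. *)
Definition word_of n (w : n.-tuple 'I_n) : seq nat := [seq val i | i <- w].

Lemma catalan_word_bound (w : seq nat) :
  catalan_word w -> all (fun a => a < size w) w.
Proof.
have aux (s : seq nat) (a : nat) : path (fun a b => b <= a.+1) a s ->
    all (fun b => b <= a + size s) (a :: s).
  elim: s a => [|b s IHs] a /=; first by rewrite addn0 leqnn.
  case/andP=> le_ba /IHs /= /andP[_ sP]; rewrite leq_addr /=.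
  rewrite addnS -addSn (leq_trans le_ba) ?leq_addr //=.
  by apply: sub_all sP => c /leq_trans -> //; rewrite leq_add2r.
by case: w => // a s /andP[/eqP /= ->] /aux.
Qed.

Lemma catalan_word_tuple n (w : seq nat) :
  catalan_word w -> size w = n -> exists t : n.-tuple 'I_n, word_of t = w.
Proof.
move=> /catalan_word_bound wP sz_w; rewrite sz_w in wP.
have sz : size (pmap insub w : seq 'I_n) == n.
  by rewrite size_pmap_sub -sz_w; move: wP; rewrite all_count sz_w.
exists (Tuple sz); rewrite /word_of /= (pmap_filter (insubK _)).
by apply/all_filterP; apply: sub_all wP => a lt_an; rewrite insubT.
Qed.

Definition catalan_avoiders (p : seq nat) (n : nat) : {set n.-tuple 'I_n} :=
  [set w | catalan_word (word_of w) && avoids (word_of w) p].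

Definition descent_count (p : seq nat) (n k : nat) : nat :=
  #|[set w in catalan_avoiders p n | descents (word_of w) == k]|.

(* The outer series variable is x, the inner one y. *)
Definition catalan_gf (p : seq nat) : {fps {fps int}} :=
  FPS (fun n => FPS (fun k => (descent_count p n k)%:Z)).

Definition varx : {fps {fps int}} := fpsX.
Definition vary : {fps {fps int}} := fpsC fpsX.

Local Open Scope ring_scope.

(* Division is junk-valued outside units; this denominator is one. *)
Lemma den110_unit (x := varx) (y := vary) :
  (1 - x) * (1 - 3 * x + x ^+ 2 + 2 * x ^+ 3 - x ^+ 3 * y) \is a GRing.unit.
Proof.
have c0M (f g : {fps {fps int}}) :
    fpscoef (f * g) 0 = fpscoef f 0 * fpscoef g 0.
  by rewrite /= big_ord_recl big_ord0 addr0.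
have c0D (f g : {fps {fps int}}) :
    fpscoef (f + g) 0 = fpscoef f 0 + fpscoef g 0 by [].
have c0N (f : {fps {fps int}}) : fpscoef (- f) 0 = - fpscoef f 0 by [].
have c0x : fpscoef x 0 = 0 by [].
change (is_true (fpscoef ((1 - x) * (1 - 3 * x + x ^+ 2 + 2 * x ^+ 3
  - x ^+ 3 * y)) 0 \is a GRing.unit)).
rewrite !(c0M, c0D, c0N, exprS, c0x, mul0r, mulr0, oppr0, addr0).
by rewrite mulr1 unitr1.
Qed.

(* Main.v *)
(** Read a Catalan word from left to right.  Its letters seen so far are exactly
    0..M, so whether the next letter creates a pattern 110 depends only on the
    last letter l, the maximum M and the largest repeated letter m: the next
    letter must lie in [m, l + 1].  Every reached state has l = M or m = l.  With
    A_d the generating function of the continuations from a state with l = M and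
    d = M - m, and B_j the one for m = l and j = M - l,
    << A_d = 1 + x (y (B_1 + ... + B_d) + A_0 + A_(d+1)),
       B_(j+1) = 1 + x (B_(j+1) + B_j),   B_0 = A_0, >>
    and the series wanted is 1 + x A_0.  This infinite linear system determines
    all coefficients, and it has an explicit solution that combines constants,
    multiples of d, and powers of x / (1 - x). *)

Require Import Defs.
From mathcomp Require Import all_boot all_order all_algebra.
From mathcomp Require Import zify ring.
Import GRing.Theory.
Local Open Scope ring_scope.

(** * Coefficient extraction in formal power series *)

Section FpsCoef.
Variable R : comNzRingType.
Implicit Types f g : {fps R}.

Lemma fpscoefD f g n : fpscoef (f + g) n = fpscoef f n + fpscoef g n.
Proof. by []. Qed.

Lemma fpscoef1 n : fpscoef (1 : {fps R}) n = (n == 0)%:R.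
Proof. by case: n. Qed.

Lemma fpscoef_sum (I : Type) (r : seq I) (F : I -> {fps R}) n :
  fpscoef (\sum_(i <- r) F i) n = \sum_(i <- r) fpscoef (F i) n.
Proof. by elim/big_rec2: _ => // i a f _ <-. Qed.

Lemma fpscoefXM0 f : fpscoef (fpsX * f) 0 = 0.
Proof. by rewrite /= big_ord_recl big_ord0 /= mul0r addr0. Qed.

Lemma fpscoefXMS f n : fpscoef (fpsX * f) n.+1 = fpscoef f n.
Proof.
rewrite /= big_ord_recl big_ord_recl /= mul0r add0r mul1r subn1 /=.
by rewrite big1 ?addr0 // => i _; rewrite mul0r.
Qed.

Lemma fpscoefXn d n : fpscoef (fpsX ^+ d : {fps R}) n = (n == d)%:R.
Proof.
elim: d n => [|d IHd] [|n]; rewrite ?expr0 ?fpscoef1 // exprS.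
  by rewrite fpscoefXM0.
by rewrite fpscoefXMS IHd.
Qed.

Lemma fpscoefCM (c : R) f n : fpscoef (fpsC c * f) n = c * fpscoef f n.
Proof.
rewrite /= big_ord_recl /= subn0 big1 ?addr0 // => i _.
by rewrite mul0r.
Qed.

Lemma fps_unit_coef0 (S : comUnitRingType) (f : {fps S}) :
  fpscoef f 0 = 1 -> f \is a GRing.unit.
Proof. by move=> f1; rewrite unfold_in /= /fps_unit f1 unitr1. Qed.

End FpsCoef.

(** * Avoidance of 110 decided letter by letter *)

Local Open Scope nat_scope.

(** A 110 ends exactly at a letter lying strictly below a value that occurs twice before it; [p] is
    the prefix already read. *)
Fixpoint avoids_after (p s : seq nat) : bool :=
  if s is c :: s' then
    all (fun v => (1 < count_mem v p) ==> (v <= c)) p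
      && avoids_after (rcons p c) s'
  else true.

Lemma avoids_afterP p s :
  reflect (forall k v, k < size s -> 1 < count_mem v (p ++ take k s) ->
             v <= nth 0 s k)
          (avoids_after p s).
Proof.
elim: s p => [|c s IHs] p /=; first by constructor.
apply: (iffP andP) => [[/allP pc /IHs sP] [|k] v /= | H].
- rewrite cats0 => _ v2; apply: (implyP (pc v _)) => //.
  by rewrite -has_pred1 has_count ltnW.
- by rewrite ltnS => ks; rewrite -cat_rcons; apply: sP.
split.
  by apply/allP => v _; apply/implyP => v2; apply: (H 0); rewrite //= cats0.
by apply/IHs => k v ks; rewrite cat_rcons; apply: (H k.+1).
Qed.

Lemma count_mem_gt1P (T : eqType) (x0 v : T) (s : seq T) :
  reflect (exists i j, [/\ i < j, j < size s, nth x0 s i = v & nth x0 s j = v])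
          (1 < count_mem v s).
Proof.
apply: (iffP idP).
  elim: s => //= a s IHs; case: eqP => [-> | _] /=.
    rewrite add1n ltnS -has_count has_pred1 => vs.
    by exists 0, (index v s).+1; split; rewrite //= ?ltnS ?index_mem ?nth_index.
  by rewrite add0n => /IHs[i [j [ij js si sj]]]; exists i.+1, j.+1.
elim: s => [|a s IHs] [[|i] [[|j] []]] //=.
  move=> _ js -> sj; rewrite eqxx add1n ltnS -has_count has_pred1 -sj.
  exact: mem_nth.
move=> ij js si sj; apply: leq_trans (leq_addl _ _); apply: IHs.
by exists i, j.
Qed.

Lemma contains110P (w : seq nat) :
  reflect (exists i j k, [/\ i < j, j < k, k < size w,
             nth 0 w i = nth 0 w j & nth 0 w k < nth 0 w i])
          (contains_pattern w [:: 1; 1; 0]).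
Proof.
apply: (iffP existsP) => [[f /forallP fP] | [i [j [k [ij jk kw wij wki]]]]].
  have H a b := forallP (fP a) b.
  exists (f (inord 0)), (f (inord 1)), (f (inord 2)).
  have /and3P[h1 _ /eqP h2] := H (inord 0) (inord 1).
  have /and3P[h3 _ _] := H (inord 1) (inord 2).
  have /and3P[_ /eqP h4 _] := H (inord 2) (inord 0).
  move: h1 h2 h3 h4; rewrite !inordK //= => h1 /eqP h2 h3 h4.
  by split.
have iw : i < size w by lia.
have jw : j < size w by lia.
exists [ffun a : 'I_3 => if a == 0 :> nat then Ordinal iw else
          if a == 1 :> nat then Ordinal jw else Ordinal kw].
apply/forallP => a; apply/forallP => b; rewrite !ffunE.
by case: a b => [[|[|[|a]]] ?] [[|[|[|b]]] ?] //=; lia.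
Qed.

Lemma avoids110E w : avoids w [:: 1; 1; 0] = avoids_after [::] w.
Proof.
rewrite /avoids; apply/idP/avoids_afterP => [/negP nw k v kw | H].
  move=> /(count_mem_gt1P _ 0)[i [j []]]; rewrite size_takel ?(ltnW kw) // => ij jk.
  rewrite !nth_take ?(ltn_trans ij) // => wi wj; rewrite leqNgt.
  apply/negP => lt_wv; apply: nw; apply/contains110P.
  by exists i, j, k; split=> //; rewrite wi.
apply/negP => /contains110P[i [j [k [ij jk kw wij]]]].
apply/negP; rewrite -leqNgt; apply: H => //.
apply/(count_mem_gt1P _ 0); exists i, j.
by split; rewrite ?size_takel ?(ltnW kw) // nth_take // (ltn_trans ij).
Qed.

(* [m] is the largest letter already repeated (0 if there is none), [l] the
   last letter and [M] the largest letter: the letters already read being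
   exactly 0..M, the next letter [c] is a repetition iff [c <= M]. *)
Fixpoint admissible (m l M : nat) (s : seq nat) : bool :=
  if s is c :: s' then
    [&& m <= c, c <= l.+1 & admissible (if c <= M then c else m) c (maxn M c) s']
  else true.

(** The hypotheses are the invariant tying the prefix [p] to the state. A letter [c <= M] already
    occurs in [p], so it becomes repeated and, being at least [m], the new largest repeated
    letter. *)
Lemma admissibleE (p s : seq nat) (m l M : nat) :
    (forall v, (v \in p) = (v <= M)) -> m <= l <= M ->
    (0 < m -> 1 < count_mem m p) ->
    (forall v, 1 < count_mem v p -> v <= m) ->
  path (fun a b => b <= a.+1) l s && avoids_after p s = admissible m l M s.
Proof.
elim: s p m l M => //= c s IHs p m l M pM /andP[ml lM] m2 mmax.
have -> : all (fun v => (1 < count_mem v p) ==> (v <= c)) p = (m <= c).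
  apply/allP/idP => [H | mc v _].
    (* The default [m = 0] imposes no lower bound. *)
    case: (posnP m) => [-> // | m_gt0].
    by apply: (implyP (H m _)); rewrite ?pM ?m2 // (leq_trans ml).
  by apply/implyP => /mmax vm; apply: leq_trans mc.
rewrite andbACA [RHS]andbA [_ && (m <= c)]andbC.
case: leqP => //= mc; case: leqP => //= cl.
have cp : count_mem c p > 0 = (c <= M) by rewrite -pM -has_pred1 has_count.
have cnt (v : nat) : count_mem v (rcons p c) = count_mem v p + (c == v).
  by rewrite -cats1 count_cat /= addn0.
apply: IHs => [v | | | v]; rewrite ?cnt.
- by rewrite mem_rcons inE pM; lia.
- by case: ifP => cM; lia.
- case: ifP => cM; first by rewrite eqxx; lia.
  by move/m2/leq_trans; apply; apply: leq_addr.
case: eqP => [<- | _].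
  by case: ifP => cM //; lia.
by rewrite addn0 => /mmax; case: ifP; lia.
Qed.

(** * Enumeration of continuations and descent counts *)

Fixpoint admissible_words (n m l M : nat) : seq (seq nat) :=
  if n is n'.+1 then
    [seq c :: s | c <- iota m (l.+2 - m),
                  s <- admissible_words n' (if c <= M then c else m) c (maxn M c)]
  else [:: [::]].

Lemma mem_admissible_words n m l M s : m <= l ->
  (s \in admissible_words n m l M) = (size s == n) && admissible m l M s.
Proof.
elim: n m l M s => [|n IHn] m l M [|c s] //= ml.
  by apply/allpairsPdep => -[c [s []]].
have ml' : (m <= c) -> (if c <= M then c else m) <= c by case: ifP.
rewrite eqSS; apply/allpairsPdep/idP.
  move=> [d [t [+ + [-> ->]]]]; rewrite mem_iota => dm.
  have md : (if d <= M then d else m) <= d by case: ifP => _ //; lia.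
  rewrite IHn // => /andP[-> ->]; lia.
case/and4P=> sn mc cl ok; exists c, s; split=> //.
  by rewrite mem_iota; lia.
by rewrite IHn ?sn // ml'.
Qed.

Lemma admissible_words_uniq n m l M : uniq (admissible_words n m l M).
Proof.
elim: n m l M => //= n IHn m l M; apply: allpairs_uniq_dep => //.
  exact: iota_uniq.
by move=> [a s] [b t] _ _ /= [-> ->].
Qed.

Fixpoint descents_from (l : nat) (s : seq nat) : nat :=
  if s is c :: s' then (c < l) + descents_from c s' else 0.

Lemma descents_cons l s : descents (l :: s) = descents_from l s.
Proof.
rewrite /descents; elim: s l => [|c s IHs] l /=; first by rewrite big_ord0.
by rewrite big_ord_recl /= -IHs.
Qed.

(** Prefixing the forced first letter 0 matches continuations with words; both lists are
    duplicate-free with the same members. *)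
Lemma descent_count110S n k :
  descent_count [:: 1; 1; 0] n.+1 k =
    count (fun s => descents_from 0 s == k) (admissible_words n 0 0 0).
Proof.
rewrite /descent_count cardE -(size_map (@word_of n.+1)) -size_filter.
rewrite -[RHS](size_map (cons 0)); apply/perm_size/uniq_perm.
- rewrite map_inj_uniq ?enum_uniq // => s t /(inj_map val_inj) st.
  exact: val_inj.
- rewrite map_inj_uniq ?filter_uniq ?admissible_words_uniq //.
  by move=> s t [].
have mainE s : catalan_word (0 :: s) && avoids (0 :: s) [:: 1; 1; 0]
               = admissible 0 0 0 s.
  rewrite avoids110E /catalan_word /= -(@admissibleE [:: 0]) // => v /=.
    by rewrite inE leqn0.
  by case: eqP => [<- | _].
move=> w; apply/mapP/mapP => [[t] | [s]].
  rewrite mem_enum !inE => /andP[tP td] ->.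
  have sz : size (word_of t) = n.+1 by rewrite size_map size_tuple.
  case: (word_of t) sz tP td => // a s [sz] tP td.
  have a0 : a = 0 by case/andP: tP => /andP[/eqP].
  rewrite a0 in tP td *; exists s => //.
  by rewrite mem_filter mem_admissible_words // sz eqxx -mainE tP -descents_cons td.
rewrite mem_filter mem_admissible_words // -mainE.
case/and3P=> sd /eqP sz sP ->.
have [|| t tE] := @catalan_word_tuple n.+1 (0 :: s).
- by case/andP: sP.
- by rewrite /= sz.
by exists t; rewrite // mem_enum !inE tE sP descents_cons sd.
Qed.

Lemma descent_count110_0 k : descent_count [:: 1; 1; 0] 0 k = (k == 0).
Proof.
rewrite /descent_count.
have w0 (w : 0.-tuple 'I_0) : word_of w = [::] by rewrite (tuple0 w).
have ok : avoids [::] [:: 1; 1; 0] by rewrite avoids110E.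
have d0 : descents [::] = 0 by rewrite /descents big_ord0.
under eq_finset => w do rewrite inE w0 ok d0 /= eq_sym.
case: eqP => _; last by rewrite cards0.
by rewrite cardsT card_tuple expn0.
Qed.

(** * Recurrences for the continuation series *)

Local Open Scope ring_scope.

Definition descent_series (n m l M : nat) : {fps int} :=
  \sum_(s <- admissible_words n m l M) fpsX ^+ descents_from l s.

Lemma coef_descent_series n m l M k :
  fpscoef (descent_series n m l M) k =
    (count (fun s => descents_from l s == k) (admissible_words n m l M))%:Z.
Proof.
rewrite fpscoef_sum; elim: admissible_words => [|s r IHr]; first by rewrite big_nil.
by rewrite big_cons IHr fpscoefXn /= PoszD eq_sym; case: eqP.
Qed.

Lemma descent_series0 m l M : descent_series 0 m l M = 1.
Proof. by rewrite /descent_series big_seq1. Qed.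

Lemma descent_seriesS n m l M :
  descent_series n.+1 m l M =
    \sum_(c <- iota m (l.+2 - m)) fpsX ^+ (c < l)%N *
      descent_series n (if (c <= M)%N then c else m) c (maxn M c).
Proof.
rewrite /descent_series /= big_allpairs_dep /=; apply: eq_bigr => c _.
by rewrite mulr_sumr; apply: eq_bigr => s _; rewrite exprD.
Qed.

(** Split by the next letter: [m + i] below [l] gives a descent and becomes the repeated letter; [l]
    itself is repeated; [l + 1] is a new maximum and keeps [m]. *)
Lemma descent_series_top n m d :
  descent_series n.+1 m (m + d) (m + d) =
    \sum_(i < d) fpsX * descent_series n (m + i) (m + i) (m + i + (d - i))
    + descent_series n (m + d) (m + d) (m + d)
    + descent_series n m (m + d.+1) (m + d.+1).
Proof.
rewrite descent_seriesS (_ : (m + d).+2 - m = d.+2)%N; last by lia.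
rewrite -[m in iota m _]addn0 iotaDl big_map -[iota 0 _]/(index_iota 0 d.+2).
rewrite big_mkord 2!big_ord_recr /=.
congr (_ + _ + _).
- apply: eq_bigr => i _; rewrite ltn_add2l ltn_ord leq_add2l (ltnW (ltn_ord i)).
  rewrite expr1; congr (_ * descent_series _ _ _ _).
  by rewrite -addnA subnKC ?(ltnW (ltn_ord i)) //; apply/maxn_idPl; rewrite leq_add2l ltnW.
- by rewrite ltnn leqnn mul1r maxnn.
- rewrite ltn_add2l leq_add2l ltnn ltnNge leqnSn mul1r; congr (descent_series _ _ _ _).
  by apply/maxn_idPr; rewrite leq_add2l.
Qed.

(** Only [l] and [l + 1] may follow; both are at most [M], hence repeated, and neither makes a
    descent. *)
Lemma descent_series_below n m j :
  descent_series n.+1 m m (m + j.+1) =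
    descent_series n m m (m + j.+1) + descent_series n m.+1 m.+1 (m.+1 + j).
Proof.
rewrite descent_seriesS (_ : m.+2 - m = 2)%N; last by lia.
rewrite /= !big_cons big_nil ltnn ltnNge leqnSn !mul1r addr0 leq_addr.
rewrite (_ : m < m + j.+1)%N; last by lia.
by congr (descent_series _ _ _ _ + descent_series _ _ _ _); lia.
Qed.

(** * The linear system determines the generating function *)

Section SystemUniqueness.
Variables A B : nat -> {fps {fps int}}.
Local Notation x := varx.
Local Notation y := vary.
Hypothesis BA0 : B 0%N = A 0%N.
Hypothesis BS : forall j, B j.+1 = 1 + x * (B j.+1 + B j).
Hypothesis AS : forall d,
  A d = 1 + x * (y * (\sum_(i < d) B (d - i)%N) + A 0%N + A d.+1).

(** Every unknown on the right carries a factor [x], so coefficients of order [n] in both families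
    fix those of order [n + 1]. *)
Lemma descent_series_system n :
  (forall m d, descent_series n m (m + d) (m + d) = fpscoef (A d) n) /\
  (forall m j, descent_series n m m (m + j) = fpscoef (B j) n).
Proof.
elim: n => [|n [IHA IHB]].
  have A0 d : fpscoef (A d) 0 = 1 by rewrite AS fpscoefD fpscoefXM0 addr0.
  split=> [m d|m [|j]]; rewrite descent_series0 ?A0 ?BA0 ?A0 //.
  by rewrite BS fpscoefD fpscoefXM0 addr0.
have IHA0 k : descent_series n k k k = fpscoef (A 0%N) n.
  by rewrite -(IHA k) addn0.
have step m d :
    descent_series n.+1 m (m + d) (m + d) = fpscoef (A d) n.+1.
  rewrite descent_series_top AS fpscoefD fpscoef1 add0r fpscoefXMS !fpscoefD.
  rewrite fpscoefCM IHA IHA0 fpscoef_sum mulr_sumr; congr (_ + _ + _).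
  by apply: eq_bigr => i _; rewrite IHB.
split=> // m [|j]; first by rewrite BA0 -(step m) addn0.
by rewrite descent_series_below BS fpscoefD fpscoef1 add0r fpscoefXMS fpscoefD !IHB.
Qed.

Lemma catalan_gf110 : catalan_gf [:: 1; 1; 0]%N = 1 + x * A 0%N.
Proof.
apply: fpsP => -[|n]; apply: fpsP => k.
  rewrite fpscoefD fpscoefXM0 addr0 fpscoef1 /=.
  by rewrite descent_count110_0; case: eqP.
rewrite fpscoefD fpscoef1 add0r fpscoefXMS -[LHS]/((descent_count _ _ _)%:Z).
have [/(_ 0%N 0%N) <- _] := descent_series_system n.
by rewrite descent_count110S coef_descent_series.
Qed.

End SystemUniqueness.

(** * Explicit solution of the system *)

Section SystemSolution.
Variables (R : comNzRingType) (x y u v t : R).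
Let Q := 1 - 3 * x + x ^+ 2 + 2 * x ^+ 3 - x ^+ 3 * y.
Hypothesis uE : u * (1 - x) = 1.
Hypothesis vE : v * (1 - 2 * x) = 1.
Hypothesis tE : t * Q = 1.

(* [B_j] is affine in [r ^+ j] with [r = x / (1 - x)] and fixed point [v]; then
   [A_d] is sought as [a + b d + c r ^+ d], with [A_0] as in the theorem. *)
Definition sol_below (j : nat) : R :=
  v + (x * u) ^+ j * (x ^+ 2 * y * (1 - x - x ^+ 2) * u * v * t).

Definition sol_top (d : nat) : R :=
  sol_below 0 + x * y * u * v *+ d
  + x ^+ 4 * y ^+ 2 * v ^+ 2 * t * (1 - (x * u) ^+ d).

(** These vanishing defects serve as certificates: each identity below is a combination of them with
    explicit cofactors, which [ring] can check. *)
Let eu := u * (1 - x) - 1.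
Let ev := v * (1 - 2 * x) - 1.
Let et := t * Q - 1.

Let eu0 : eu = 0. Proof. by rewrite /eu uE subrr. Qed.
Let ev0 : ev = 0. Proof. by rewrite /ev vE subrr. Qed.
Let et0 : et = 0. Proof. by rewrite /et tE subrr. Qed.

Lemma sol_below0 : sol_below 0 = sol_top 0.
Proof. by rewrite /sol_top mulr0n expr0 subrr mulr0 !addr0. Qed.

Lemma sol_belowS j :
  sol_below j.+1 = 1 + x * (sol_below j.+1 + sol_below j).
Proof.
rewrite /sol_below exprS; set r := (x * u) ^+ j; set k := _ * t.
apply/eqP; rewrite -subr_eq0; apply/eqP.
transitivity (ev + x * r * k * eu); first by rewrite /ev /eu; ring.
by rewrite ev0 eu0; ring.
Qed.

Lemma sol_top0 : sol_top 0 = 1 + x * (sol_top 0 + sol_top 1).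
Proof.
rewrite /sol_top /sol_below expr0 expr1 mulr0n mulr1n.
apply/eqP; rewrite -subr_eq0; apply/eqP.
transitivity (ev * (1 - x ^+ 5 * y ^+ 2 * v * t * u)
  + x ^+ 5 * y ^+ 2 * v ^+ 2 * t * eu + x ^+ 2 * y * u * v * et).
  by rewrite /ev /eu /et /Q; ring.
by rewrite ev0 eu0 et0; ring.
Qed.

(** Subtracting consecutive equations for [A_d] leaves only [B_(d+1)] of the sum; with the case
    [d = 0] this recovers them all. *)
Lemma sol_topB d : sol_top d.+1 - sol_top d =
  x * (sol_top d.+2 - sol_top d.+1) + x * (y * sol_below d.+1).
Proof.
rewrite /sol_top /sol_below expr0 !exprS !mulrS; set r := (x * u) ^+ d.
apply/eqP; rewrite -subr_eq0; apply/eqP.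
transitivity (x * y * v * eu + r * x ^+ 4 * y ^+ 2 * v * t *
  (- u * eu + (u * ev - v * eu) * (u * (1 - x - x ^+ 2) - eu))).
  by rewrite /ev /eu; ring.
by rewrite ev0 eu0; ring.
Qed.

Lemma sol_topE d : sol_top d =
  1 + x * (y * (\sum_(i < d) sol_below (d - i)) + sol_top 0 + sol_top d.+1).
Proof.
elim: d => [|d IHd]; first by rewrite big_ord0 mulr0 add0r -sol_top0.
rewrite big_ord_recl subn0.
under eq_bigr => i _ do rewrite /= /bump add1n subSS.
rewrite -[LHS](subrK (sol_top d)) sol_topB [X in _ + X = _]IHd; ring.
Qed.

(** The factor [1 - 2 * x] cancels, since [(1 - x) * Q + x ^+ 2 * y * (1 - x - x ^+ 2)] equals it
    times the right-hand side. *)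
Lemma sol_top0_mul :
  sol_top 0 * ((1 - x) * Q) = 1 - 2 * x + x ^+ 2 * y + x ^+ 3.
Proof.
rewrite -sol_below0 /sol_below expr0.
apply/eqP; rewrite -subr_eq0; apply/eqP.
transitivity (ev * (1 - 2 * x + x ^+ 2 * y + x ^+ 3)
  + x ^+ 2 * y * (1 - x - x ^+ 2) * v * ((eu + 1) * (et + 1) - 1)).
  by rewrite /ev /eu /et /Q; ring.
by rewrite ev0 eu0 et0; ring.
Qed.

End SystemSolution.

Theorem theorem12 (x := varx) (y := vary) :
  catalan_gf [:: 1; 1; 0]%N =
    (1 - 3 * x + 2 * x ^+ 2 + x ^+ 3 - x ^+ 4 + x ^+ 4 * y)
    / ((1 - x) * (1 - 3 * x + x ^+ 2 + 2 * x ^+ 3 - x ^+ 3 * y)).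
Proof.
have unitD : (1 - x) * (1 - 3 * x + x ^+ 2 + 2 * x ^+ 3 - x ^+ 3 * y)
  \is a GRing.unit := den110_unit.
have := unitD; rewrite unitrM => /andP[/mulVr uE /mulVr tE].
(* The solution also uses the inverse of [1 - 2 * x], whose constant coefficient is 1. *)
have vE : (1 - 2 * x)^-1 * (1 - 2 * x) = 1.
  apply/mulVr/fps_unit_coef0.
  by rewrite fpscoefD fpscoef1 mulrC -mulrN fpscoefXM0 addr0.
rewrite (catalan_gf110 _ _ (sol_below0 _ _ _ _ _ _) (sol_belowS _ _ _ _ _ _ uE vE)
  (sol_topE _ _ _ _ _ _ uE vE tE)).
apply: (mulIr unitD); rewrite divrK // mulrDl -[x * sol_top _ _ _ _ _ _ _ * _]mulrA.
rewrite (sol_top0_mul _ _ _ _ _ _ uE vE tE); ring.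
Qed.
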